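(* Let $m$, $n$ and $q$ be positive integers such that $q$ is even or $mnq$ is odd. Then \[ \sum_{k = 1}^\infty \frac{(-1)^{k-1}F_{2nk+mnq}}{\prod_{j=0}^{m} L_{nk+jnq}^2} = \frac{1}{5F_{mnq}}\sum_{k=1}^{q}\frac{(-1)^{k-1}}{\prod_{j=0}^{m-1}L_{nk+jnq}^2}. \]
   Context: The Fibonacci numbers are defined by $F_0=0$, $F_1=1$, $F_n=F_{n-1}+F_{n-2}$, and the Lucas numbers by $L_0=2$, $L_1=1$, $L_n=L_{n-1}+L_{n-2}$. Infinite sums are limits of partial sums. *)

(* Defs.v *)
From mathcomp Require Import all_boot.

Set Implicit Arguments.
Unset Strict Implicit.
Unset Printing Implicit Defensive.

Fixpoint fib (n : nat) : nat :=
  match n with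
  | 0 => 0
  | 1 => 1
  | (n'.+1 as p).+1 => fib p + fib n'
  end.

Fixpoint lucas (n : nat) : nat :=
  match n with
  | 0 => 2
  | 1 => 1
  | (n'.+1 as p).+1 => lucas p + lucas n'
  end.

(* Main.v *)
Require Import Defs.
From mathcomp Require Import all_boot all_order all_algebra.
From mathcomp Require Import all_classical all_reals all_analysis.
From mathcomp Require Import ring.
Import Order.TTheory GRing.Theory Num.Theory numFieldNormedType.Exports.
Local Open Scope classical_set_scope.
Local Open Scope ring_scope.

(** Put [d = m n q] and [P k = \prod_(j < m) L_(nk + jnq)^2].  The identity
    [L_(a+d)^2 - (-1)^d L_a^2 = 5 F_d F_(2a+d)] with [a = nk] turns the [k]-th
    term into [(g k - g (k + q)) / (5 F_d)], where [g k = (-1)^(k-1) / P k];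
    the parity hypothesis says exactly that [(-1)^d = (-1)^q].  The series
    therefore telescopes with step [q], and [g] tends to [0]. *)

Lemma fibSS n : fib n.+2 = (fib n.+1 + fib n)%N.
Proof. by []. Qed.

Lemma lucasSS n : lucas n.+2 = (lucas n.+1 + lucas n)%N.
Proof. by []. Qed.

Lemma fib_gt0 n : (0 < n)%N -> (0 < fib n)%N.
Proof.
case: n => // n _; elim: n => // n IHn.
by rewrite fibSS addn_gt0 IHn.
Qed.

Lemma leq_lucas n : (n <= lucas n)%N.
Proof.
(* The two-term recurrence needs bounds at two consecutive indices; the strict one at [n.+1] is the
   next weak one. *)
suff: (n <= lucas n)%N && (n < lucas n.+1)%N by case/andP.
elim: n => // n /andP[le_n lt_n]; rewrite lt_n lucasSS /=.
case: n le_n lt_n => // n le_n lt_n.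
by rewrite -[n.+3]addn1 leq_add // (leq_trans _ le_n).
Qed.

Lemma lucas_gt0 n : (0 < lucas n)%N.
Proof. by case: n => // n; apply: leq_trans (leq_lucas _). Qed.

Section FibonacciRing.
Variable R : comNzRingType.
Implicit Types a d n : nat.
Local Notation F n := ((fib n)%:R : R).
Local Notation L n := ((lucas n)%:R : R).

Lemma natr_fibSS n : F n.+2 = F n.+1 + F n.
Proof. by rewrite fibSS natrD. Qed.

(** This is [L_n = F_(n+1) + F_(n-1)] with the predecessor eliminated, so that it also holds at
    [n = 0]. *)
Lemma natr_lucas n : L n = 2 * F n.+1 - F n.
Proof.
suff: L n = 2 * F n.+1 - F n /\ L n.+1 = 2 * F n.+2 - F n.+1 by case.
elim: n => [|n [IH0 IH1]]; first by rewrite /=; split; ring.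
by split=> //; rewrite lucasSS natrD IH0 IH1 !natr_fibSS; ring.
Qed.

(** The factor [F a.+1 - F a] stands for [F_(a-1)]. The two formulas feed each other through the
    recurrence, hence the joint induction. *)
Lemma natr_fib_add a d :
  F (a + d) = F a * F d.+1 + (F a.+1 - F a) * F d /\
  F (a + d).+1 = F a.+1 * F d.+1 + F a * F d.
Proof.
elim: a => [|a [IH0 IH1]]; first by rewrite add0n /=; split; ring.
by rewrite !addSn !natr_fibSS IH0 IH1; split; ring.
Qed.

(** Cassini's identity with [F_(d-1)] eliminated; it turns the sign into a quadratic form in [F d]
    and [F d.+1]. *)
Lemma fib_cassini d : (-1) ^+ d = F d.+1 ^+ 2 - F d * F d.+1 - F d ^+ 2.
Proof.
elim: d => [|d IHd]; first by rewrite /=; ring.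
by rewrite exprS IHd natr_fibSS; ring.
Qed.

(** The addition formulas and Cassini reduce both sides to polynomials in [F a], [F a.+1], [F d],
    [F d.+1], which [ring] compares. *)
Lemma lucas_sqr_sub a d :
  L (a + d) ^+ 2 - (-1) ^+ d * L a ^+ 2 = 5 * F d * F (2 * a + d).
Proof.
have [E0 E1] := natr_fib_add a d.
rewrite mul2n -addnn -addnA (natr_fib_add a (a + d)).1.
by rewrite fib_cassini !natr_lucas E0 E1; ring.
Qed.

End FibonacciRing.

Lemma telescope_sum_step (V : zmodType) (g : nat -> V) (q N : nat) :
  \sum_(1 <= k < N.+1) (g k - g (k + q)%N) =
  \sum_(1 <= k < q.+1) g k - \sum_(i < q) g (N.+1 + i)%N.
Proof.
elim: N => [|N IHN].
  rewrite big_geq // big_add1 big_mkord; apply/eqP.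
  by rewrite eq_sym subr_eq0; apply/eqP/eq_bigr => i _; rewrite add1n.
rewrite big_nat_recr //= {}IHN -addrA; congr (_ + _).
(* Both sides sum [g] over the window from [N.+1] to [N.+1 + q], split at opposite ends. *)
have : g N.+1 + \sum_(i < q) g (N.+2 + i)%N =
       \sum_(i < q) g (N.+1 + i)%N + g (N.+1 + q)%N.
  rewrite -(big_ord_recr _ (fun i => g (N.+1 + i)%N)) big_ord_recl addn0.
  by congr (_ + _); apply: eq_bigr => i _; rewrite addSnnS.
move/(canRL (addKr _)) => ->.
by rewrite !opprD opprK addrCA.
Qed.

Theorem theorem2p44 (R : realType) (m n q : nat)
    (hm : (0 < m)%N) (hn : (0 < n)%N) (hq : (0 < q)%N)
    (hpar : ~~ odd q \/ odd (m * n * q)) :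
  (\sum_(1 <= k < N.+1)
      (-1) ^+ (k - 1)%N * (fib (2 * n * k + m * n * q))%:R
      / \prod_(0 <= j < m.+1) (lucas (n * k + j * n * q))%:R ^+ 2 : R)
    @[N --> \oo] -->
  (1 / (5 * (fib (m * n * q))%:R)
    * \sum_(1 <= k < q.+1)
        (-1) ^+ (k - 1)%N
        / \prod_(0 <= j < m) (lucas (n * k + j * n * q))%:R ^+ 2 : R).
Proof.
set d := (m * n * q)%N; set c : R := 1 / (5 * _).
pose L2 k j : R := (lucas (n * k + j * n * q))%:R ^+ 2.
pose P k := \prod_(0 <= j < m) L2 k j.
pose g k : R := (-1) ^+ (k - 1)%N / P k.
have L2_ge1 k j : 1 <= L2 k j by rewrite exprn_ege1 // ler1n lucas_gt0.
have L2_neq0 k j : L2 k j != 0 by rewrite gt_eqF // (lt_le_trans ltr01).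
have P_neq0 k : P k != 0 by rewrite prodf_seq_neq0; apply/allP => j _; apply: L2_neq0.
have F_neq0 : (fib d)%:R != 0 :> R.
  by rewrite pnatr_eq0 -lt0n fib_gt0 // /d !muln_gt0 hm hn hq.
have sign_d : (-1) ^+ d = (-1) ^+ q :> R.
  rewrite -signr_odd -[RHS]signr_odd /d oddM; congr (_ ^+ nat_of_bool _).
  (* If [q] is even, so is [d]; if [m n q] is odd, all its factors are. *)
  by case: hpar => [/negbTE->|]; rewrite ?andbF // oddM => /andP[-> ->].
(* Replacing [k] by [k + q] moves the index [nk + jnq] to [nk + (j+1)nq], so both sides are the
   product over [0 <= j <= m]. *)
have P_shift k : P k * L2 k m = L2 k 0%N * P (k + q)%N.
  rewrite /P -big_nat_recr // big_nat_recl //=; congr (_ * _).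
  by apply: eq_bigr => j _; rewrite /L2; do 3!f_equal; ring.
have term k : (0 < k)%N ->
    (-1) ^+ (k - 1)%N * (fib (2 * n * k + d))%:R
      / \prod_(0 <= j < m.+1) L2 k j = c * (g k - g (k + q)%N).
  move=> k_gt0; have := lucas_sqr_sub R (n * k) d.
  rewrite big_nat_recr //= -/(P k) mulnA sign_d.
  have -> : (lucas (n * k + d))%:R ^+ 2 = L2 k m by [].
  have -> : (lucas (n * k))%:R ^+ 2 = L2 k 0%N by rewrite /L2 !mul0n addn0.
  (* As [0 < k], the truncated [(k + q) - 1] equals [(k - 1) + q], and the sign of [g (k + q)]
     splits off [(-1) ^+ q]. *)
  rewrite /c /g -addnBAC // exprD => E.
  have -> : (fib (2 * n * k + d))%:R
      = (L2 k m - (-1) ^+ q * L2 k 0%N) / (5 * (fib d)%:R) :> R.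
    by rewrite E; field.
  have -> : P (k + q)%N = P k * L2 k m / L2 k 0%N.
    by rewrite P_shift; field.
  by field; rewrite F_neq0 !L2_neq0 P_neq0.
have norm_g k : (0 < k)%N -> `|g k| <= k%:R^-1.
  move=> k_gt0; rewrite /g normrM normrX normrN1 expr1n mul1r normfV.
  (* The factor [j = 0] alone is at least [L_(nk) >= nk >= k]; the others are at least 1. *)
  have k_le_P : k%:R <= P k.
    rewrite /P -(prednK hm) big_nat_recl //.
    apply: (@le_trans _ _ (L2 k 0%N)).
      rewrite /L2 !mul0n addn0 -natrX ler_nat.
      apply: leq_trans (leq_pmulr _ (lucas_gt0 _)).
      by apply: leq_trans (leq_lucas _); apply: leq_pmull.
    rewrite ler_peMr ?(le_trans ler01) //.
    by elim/big_ind: _ => // x y ? ?; apply: mulr_ege1.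
  have k_pos : 0 < k%:R :> R by rewrite ltr0n.
  rewrite ger0_norm ?(le_trans (ltW k_pos)) // lef_pV2 ?posrE //.
  exact: lt_le_trans k_le_P.
have g_cvg0 i : g (N.+1 + i)%N @[N --> \oo] --> (0 : R).
  apply: (@squeeze_cvgr _ _ _ _ (- harmonic) harmonic).
  - apply: nearW => N; rewrite -ler_norml (le_trans (norm_g _ _)) ?addSn //.
    by rewrite lef_pV2 ?posrE ?ltr0n // ler_nat ltnS leq_addr.
  - by rewrite -oppr0; apply: cvgN; exact: cvg_harmonic.
  - exact: cvg_harmonic.
have -> : (fun N => \sum_(1 <= k < N.+1)
      (-1) ^+ (k - 1)%N * (fib (2 * n * k + d))%:R
      / \prod_(0 <= j < m.+1) L2 k j) =
    fun N => c * (\sum_(1 <= k < q.+1) g k - \sum_(i < q) g (N.+1 + i)%N).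
  apply/funext => N; rewrite -telescope_sum_step mulr_sumr.
  by apply: eq_big_nat => k /andP[k_gt0 _]; exact: term.
apply: cvgMl_tmp; rewrite -[X in _ --> X]subr0; apply: cvgB; first exact: cvg_cst.
(* The remainder always has [q] terms, so termwise limits suffice. *)
have : \sum_(i < q) g (N.+1 + i)%N @[N --> \oo] --> \sum_(i < q) (0 : R).
  by apply: cvg_big => // ?; exact: add_continuous.
by rewrite big1.
Qed.
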